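(* Let $A$ be a coherent quantale. The following are equivalent: (1) $A$ is hyperarchimedean; (2) $L(A)$ is a Boolean algebra; (3) $Max(A)=Spec(A)$. Moreover, if $A$ is semiprime, then (1)–(3) are equivalent to: (4) $R(A)$ is a zero-dimensional frame.
   Context: A quantale is a complete lattice $(A,\vee,\wedge,0,1)$ with an associative, commutative multiplication $\cdot$ with unit $1$ distributing over arbitrary joins. $K(A)$ is the set of compact elements; $A$ is coherent if every element is a join of compact elements, $1\in K(A)$ and $K(A)$ is closed under $\cdot$. $B(A)$ is the Boolean algebra of complemented elements. $A$ is hyperarchimedean if for every $c\in K(A)$ there is an integer $n\ge1$ with $c^n\in B(A)$. An element $p<1$ is m-prime if $a\cdot b\le p$ implies $a\le p$ or $b\le p$; $Spec(A)$ is the set of m-prime elements, $Max(A)$ the set of maximal elements of $A\setminus\{1\}$. $\rho(a)=\bigwedge\{p\in Spec(A):a\le p\}$; $A$ is semiprime if $\rho(0)=0$. $R(A)=\{a:\rho(a)=a\}$ is a frame with meets $\bigwedge$ and joins $\dot\bigvee_i a_i=\rho(\bigvee_i a_i)$; a frame is zero-dimensional if every element is a join of complemented elements. The reticulation $L(A)$ is $K(A)/\!\equiv$, where $c\equiv d$ iff $\rho(c)=\rho(d)$, a bounded distributive lattice with $[c]\vee[d]=[c\vee d]$, $[c]\wedge[d]=[c\cdot d]$, bottom $[0]$, top $[1]$. *)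

(* Defs.v *)
From HB Require Import structures.
From mathcomp Require Import all_boot all_order.
From mathcomp Require Import all_classical.

Set Implicit Arguments.
Unset Strict Implicit.
Unset Printing Implicit Defensive.

Import Order.LTheory.

Local Open Scope classical_set_scope.
Local Open Scope order_scope.
Local Open Scope quotient_scope.

HB.mixin Record TBLattice_isComplete (d : Order.disp_t) T
    of Order.TBLattice d T := {
  csup : set T -> T;
  csupP : forall S : set T, supremums S (csup S)
}.

#[short(type="completeLatticeType")]
HB.structure Definition CompleteLattice (d : Order.disp_t) :=
  { T of TBLattice_isComplete d T & Order.TBLattice d T }.

Definition cinf {d : Order.disp_t} {T : completeLatticeType d} (S : set T) : T :=
  csup (lbound S).

Definition complemented {d : Order.disp_t} {T : tbLatticeType d} (x : T) : Prop :=
  exists y : T, x `&` y = \bot /\ x `|` y = \top.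

Definition boolean_algebra {d : Order.disp_t} (T : tbDistrLatticeType d) : Prop :=
  forall x : T, complemented x.

HB.mixin Record CompleteLattice_isFrame (d : Order.disp_t) T
    of CompleteLattice d T := {
  meet_csup : forall (a : T) (S : set T),
    a `&` csup S = csup [set a `&` s | s in S]
}.

#[short(type="frameType")]
HB.structure Definition Frame (d : Order.disp_t) :=
  { T of CompleteLattice_isFrame d T & CompleteLattice d T }.

Definition zero_dimensional {d : Order.disp_t} (T : frameType d) : Prop :=
  forall x : T, exists S : set T, S `<=` complemented /\ x = csup S.

HB.mixin Record Monoid_isQuantale (d : Order.disp_t) T
    of CompleteLattice d T & monoid.Monoid T := {
  mulqC : commutative ( *%g : T -> T -> T);
  oneq_top : 1%g = \top :> T;
  mulq_csup : forall (a : T) (S : set T),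
    (a * csup S)%g = csup [set (a * s)%g | s in S]
}.

(* Quantales are commutative and integral: the unit is the top element. *)
#[short(type="quantaleType")]
HB.structure Definition Quantale (d : Order.disp_t) :=
  { T of Monoid_isQuantale d T & CompleteLattice d T & monoid.Monoid T }.

Definition compact_elt {d : Order.disp_t} {T : completeLatticeType d} : set T :=
  [set c | forall S : set T, c <= csup S ->
     exists F : set T, [/\ finite_set F, F `<=` S & c <= csup F]].

HB.mixin Record Quantale_isCoherent (d : Order.disp_t) T of Quantale d T := {
  compactly_generated : forall a : T,
    exists S : set T, S `<=` compact_elt /\ a = csup S;
  compact_top : compact_elt (\top : T);
  compact_mul : forall c c' : T,
    compact_elt c -> compact_elt c' -> compact_elt (c * c')%g
}.

#[short(type="coherentQuantaleType")]
HB.structure Definition CoherentQuantale (d : Order.disp_t) :=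
  { T of Quantale_isCoherent d T & Quantale d T }.

Definition Spec {d : Order.disp_t} (A : quantaleType d) : set A :=
  [set p | p < \top /\ forall a b : A, (a * b)%g <= p -> a <= p \/ b <= p].
Arguments Spec {d} A _.

Definition Max {d : Order.disp_t} (A : quantaleType d) : set A :=
  [set m | m != \top /\ forall a : A, a != \top -> m <= a -> a = m].
Arguments Max {d} A _.

Definition rho {d : Order.disp_t} {A : quantaleType d} (a : A) : A :=
  cinf [set p | Spec A p /\ a <= p].

Definition semiprime {d : Order.disp_t} (A : quantaleType d) : Prop :=
  rho (\bot : A) = \bot.

Definition hyperarchimedean {d : Order.disp_t} (A : quantaleType d) : Prop :=
  forall c : A, compact_elt c ->
    exists n : nat, (1 <= n)%N /\ complemented (c ^+ n)%g.

Section CompleteLatticeTheory.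
Context {d : Order.disp_t} {T : completeLatticeType d}.
Implicit Types (x y : T) (S F : set T).

Lemma csup_ub S x : S x -> x <= csup S.
Proof. by have [+ _] := csupP S; exact. Qed.

Lemma csup_leP S x : csup S <= x <-> ubound S x.
Proof.
split=> [le y Sy|]; first exact: le_trans (csup_ub Sy) le.
by have [_ +] := csupP S; exact.
Qed.

Lemma le_cinfP S x : x <= cinf S <-> lbound S x.
Proof.
split=> [le y Sy|lb]; last exact: csup_ub.
by apply: le_trans le _; apply/csup_leP => z; apply.
Qed.

Lemma compact_bot : compact_elt (\bot : T).
Proof. by move=> S _; exists set0; split => //; exact: le0x. Qed.

Lemma compact_join x y :
  compact_elt x -> compact_elt y -> compact_elt (x `|` y).
Proof.
move=> cx cy S; rewrite leUx => /andP[/cx[F [fF FS xF]] /cy[G [fG GS yG]]].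
exists (F `|` G)%classic; split.
- by rewrite finite_setU.
- by move=> z [/FS|/GS].
- rewrite leUx; apply/andP; split.
  + by apply: le_trans xF _; apply/csup_leP => z Fz; apply: csup_ub; left.
  + by apply: le_trans yG _; apply/csup_leP => z Gz; apply: csup_ub; right.
Qed.

End CompleteLatticeTheory.

Section QuantaleTheory.
Context {d : Order.disp_t} {A : quantaleType d}.
Implicit Types (a b p x : A).

Lemma mulq_leWr a b x : a <= b -> (x * a <= x * b)%g.
Proof.
move=> ab.
have -> : b = csup [set a; b].
  apply/le_anti/andP; split; first by apply: csup_ub; right.
  by apply/csup_leP => y [->|->].
by rewrite mulq_csup; apply: csup_ub; exists a => //; left.
Qed.

Lemma mulq_leIl a b : (a * b)%g <= a.
Proof.
apply: (@le_trans _ _ (a * 1)%g); last by rewrite mulg1.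
by apply: mulq_leWr; rewrite oneq_top lex1.
Qed.

Lemma mulq_leIr a b : (a * b)%g <= b.
Proof. by rewrite mulqC mulq_leIl. Qed.

Lemma Spec_mul p a b : Spec A p -> ((a * b)%g <= p) = (a <= p) || (b <= p).
Proof.
move=> [_ pp]; apply/idP/orP; first exact: pp.
by case=> [|] le; apply: le_trans le; rewrite ?mulq_leIl ?mulq_leIr.
Qed.

Lemma Spec_meet p a b : Spec A p -> (a `&` b <= p) = (a <= p) || (b <= p).
Proof.
move=> sp; apply/idP/orP => [le|[] le].
- by apply/orP; rewrite -Spec_mul//; apply: le_trans le; rewrite lexI mulq_leIl mulq_leIr.
- exact: le_trans (leIl _ _) le.
- exact: le_trans (leIr _ _) le.
Qed.

Lemma le_rhoP a x : x <= rho a <-> forall p, Spec A p -> a <= p -> x <= p.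
Proof.
split=> [/le_cinfP le p sp ap|le]; first exact: le.
by apply/le_cinfP => p [sp ap]; exact: le.
Qed.

Lemma le_rho a : a <= rho a.
Proof. by apply/le_rhoP. Qed.

Lemma Spec_rho p a : Spec A p -> (rho a <= p) = (a <= p).
Proof.
move=> sp; apply/idP/idP => [|ap]; first exact: le_trans (le_rho a).
by have /le_rhoP := lexx (rho a); apply.
Qed.

Lemma rho_leP a b :
  rho a <= rho b <-> forall p, Spec A p -> b <= p -> a <= p.
Proof.
split=> [/le_rhoP le p sp bp|le]; first by rewrite -Spec_rho//; exact: le.
by apply/le_rhoP => p sp bp; rewrite Spec_rho//; exact: le.
Qed.

Lemma rho_eqP a b :
  rho a = rho b <-> forall p, Spec A p -> (a <= p) = (b <= p).
Proof.
split=> [eq p sp|eq]; first by rewrite -Spec_rho// eq Spec_rho.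
by apply/le_anti/andP; split; apply/rho_leP => p sp; rewrite eq.
Qed.

Lemma rho_idem a : rho (rho a) = rho a.
Proof. by apply/rho_eqP => p sp; exact: Spec_rho. Qed.

Lemma rhoI a b : rho (a `&` b) = rho a `&` rho b.
Proof.
apply/le_anti/andP; split.
  by rewrite lexI; apply/andP; split; apply/rho_leP => p sp le;
    apply: le_trans le; rewrite ?leIl ?leIr.
by apply/le_rhoP => p sp; rewrite !Spec_meet// !Spec_rho.
Qed.

Lemma rho_top : rho (\top : A) = \top.
Proof. by apply/le_anti; rewrite lex1 le_rho. Qed.

End QuantaleTheory.

(* The frame R(A) of radical elements: meets are those of A, while joins (and
   hence the bottom element) are the images under rho of those of A. *)
Record radElt {d : Order.disp_t} (A : quantaleType d) := RadElt {
  rad_val : A;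
  rad_valP : rho rad_val == rad_val
}.

Section RadElt.
Context {d : Order.disp_t} (A : quantaleType d).
Local Notation R := (radElt A).

HB.instance Definition _ := [isSub of R for @rad_val d A].
HB.instance Definition _ := [Choice of R by <:].
HB.instance Definition _ := [SubChoice_isSubPOrder of R by <: with d].

Implicit Types (x y z : R) (S : set R).

Lemma rho_val x : rho (val x) = val x.
Proof. exact/eqP/(valP x). Qed.

Lemma rad_leE x y : (x <= y) = (val x <= val y).
Proof. by []. Qed.

Lemma rho_rad_le (a : A) x : (rho a <= val x) = (a <= val x).
Proof.
apply/idP/idP => [|ax]; first exact: le_trans (le_rho a).
by rewrite -rho_val; apply/rho_leP => p _; exact: le_trans.
Qed.

Definition rad (a : A) : R := RadElt (introT eqP (rho_idem a)).

Fact rad_meetP x y : rho (val x `&` val y) == val x `&` val y.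
Proof. by rewrite rhoI !rho_val. Qed.

Definition rad_meet x y : R := RadElt (rad_meetP x y).
Definition rad_join x y : R := rad (val x `|` val y).
Definition rad_bot : R := rad \bot.
Definition rad_top : R := RadElt (introT eqP (@rho_top d A)).
Definition rad_csup S : R := rad (csup [set val s | s in S]).

Fact rad_lexI x y z : (x <= rad_meet y z) = (x <= y) && (x <= z).
Proof. by rewrite !rad_leE lexI. Qed.

Fact rad_leUx x y z : (rad_join x y <= z) = (x <= z) && (y <= z).
Proof. by rewrite !rad_leE /= rho_rad_le leUx. Qed.

HB.instance Definition _ :=
  Order.POrder_MeetJoin_isLattice.Build d R rad_lexI rad_leUx.

Fact rad_le0x x : rad_bot <= x.
Proof. by rewrite rad_leE /= rho_rad_le le0x. Qed.

Fact rad_lex1 x : x <= rad_top.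
Proof. by rewrite rad_leE /= lex1. Qed.

HB.instance Definition _ := Order.hasBottom.Build d R rad_le0x.
HB.instance Definition _ := Order.hasTop.Build d R rad_lex1.

Fact rad_csupP S : supremums S (rad_csup S).
Proof.
split=> [x Sx|x ubx]; rewrite rad_leE /=.
  by apply: le_trans (le_rho _); apply: csup_ub; exists x.
by rewrite rho_rad_le; apply/csup_leP => _ [y Sy <-]; exact: ubx.
Qed.

HB.instance Definition _ := TBLattice_isComplete.Build d R rad_csupP.

Lemma rad_val_meet x y : val (x `&` y) = val x `&` val y.
Proof. by []. Qed.

Lemma rad_val_join x y : val (x `|` y) = rho (val x `|` val y).
Proof. by []. Qed.

Lemma rad_val_bot : val (\bot : R) = rho \bot.
Proof. by []. Qed.

Lemma rad_val_top : val (\top : R) = \top.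
Proof. by []. Qed.

Lemma rad_val_csup S : val (csup S) = rho (csup [set val s | s in S]).
Proof. by []. Qed.

Lemma rad_val_cinf S : val (cinf S) = cinf [set val s | s in S].
Proof.
apply/le_anti/andP; split.
  apply/le_cinfP => _ [x Sx <-]; rewrite -rad_leE.
  by have /le_cinfP := lexx (cinf S); apply.
set m := cinf _; apply: le_trans (le_rho m) _.
suff : rad m <= cinf S by [].
apply/le_cinfP => x Sx; rewrite rad_leE /= rho_rad_le.
by have /le_cinfP := lexx m; apply; exists x.
Qed.

Fact rad_meet_csup x S : x `&` csup S = csup [set x `&` s | s in S].
Proof.
apply/le_anti/andP; split; last first.
  apply/csup_leP => _ [s Ss <-]; rewrite lexI leIl /=.
  exact: le_trans (leIr _ _) (csup_ub Ss).
rewrite rad_leE rad_val_meet !rad_val_csup -(rho_val x) -rhoI.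
apply/rho_leP => p sp le; rewrite Spec_meet// -Spec_mul// mulq_csup.
apply/csup_leP => _ [_ [s Ss <-] <-].
apply: le_trans le; apply: (@le_trans _ _ (val (x `&` s))).
  by rewrite rad_val_meet lexI mulq_leIl mulq_leIr.
by apply: csup_ub; exists (x `&` s) => //; exists s.
Qed.

HB.instance Definition _ := CompleteLattice_isFrame.Build d R rad_meet_csup.

End RadElt.

Record compactElt {d : Order.disp_t} (A : completeLatticeType d) := CompactElt {
  compact_val : A;
  compact_valP : `[< compact_elt compact_val >]
}.

HB.instance Definition _ (d : Order.disp_t) (A : completeLatticeType d) :=
  [isSub of compactElt A for @compact_val d A].
HB.instance Definition _ (d : Order.disp_t) (A : completeLatticeType d) :=
  [Choice of compactElt A by <:].

(* The reticulation L(A): compact elements modulo equality of their radicals.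
   The operations are computed on representatives; ret_pi_meet, ret_pi_join,
   ret_pi_bot and ret_pi_top show that they are the expected ones on classes. *)
Section Reticulation.
Context {d : Order.disp_t} (A : coherentQuantaleType d).
Local Notation K := (compactElt A).
Implicit Types (c e : K).

Definition ret_equiv : rel K := fun c e => rho (val c) == rho (val e).

Fact ret_equiv_refl : reflexive ret_equiv.
Proof. by move=> c; exact: eqxx. Qed.

Fact ret_equiv_sym : symmetric ret_equiv.
Proof. by move=> c e; exact: eq_sym. Qed.

Fact ret_equiv_trans : transitive ret_equiv.
Proof. by move=> e c f /eqP ce /eqP ef; apply/eqP; rewrite ce. Qed.

Canonical ret_equiv_rel :=
  EquivRel ret_equiv ret_equiv_refl ret_equiv_sym ret_equiv_trans.

Definition reticulation : Type := {eq_quot ret_equiv}.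

HB.instance Definition _ := Choice.on reticulation.
HB.instance Definition _ := EqQuotient.on reticulation.

Local Notation L := reticulation.
Implicit Types (x y z : L).

Lemma compactEltP c : compact_elt (val c).
Proof. exact/asboolP/(valP c). Qed.
Arguments compactEltP : clear implicits.

Definition compact_joinK c e : K :=
  CompactElt (asboolT (compact_join (compactEltP c) (compactEltP e))).
Definition compact_mulK c e : K :=
  CompactElt (asboolT (compact_mul _ _ (compactEltP c) (compactEltP e))).
Definition compact_botK : K := CompactElt (asboolT compact_bot).
Definition compact_topK : K := CompactElt (asboolT compact_top).

Definition ret_meet x y : L := \pi_L (compact_mulK (repr x) (repr y)).
Definition ret_join x y : L := \pi_L (compact_joinK (repr x) (repr y)).
Definition ret_le : rel L := fun x y => ret_meet x y == x.
Definition ret_lt : rel L := fun x y => (y != x) && ret_le x y.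

Lemma ret_piP c e : \pi_L c = \pi_L e <->
  forall p : A, Spec A p -> (val c <= p) = (val e <= p).
Proof.
rewrite -rho_eqP; split=> [/eqP|eq].
  by rewrite (@pi_eq_quot _ ret_equiv) => /eqP.
by apply/eqP; rewrite (@pi_eq_quot _ ret_equiv); apply/eqP.
Qed.

Lemma ret_reprP c (p : A) : Spec A p ->
  (val (repr (\pi_L c)) <= p) = (val c <= p).
Proof. by move: p; apply/ret_piP; rewrite reprK. Qed.

Lemma ret_eqP x y :
  (forall p : A, Spec A p -> (val (repr x) <= p) = (val (repr y) <= p)) ->
  x = y.
Proof. by rewrite -{2}(reprK x) -{2}(reprK y) => eq; apply/ret_piP. Qed.

Lemma ret_meet_leP x y (p : A) : Spec A p ->
  (val (repr (ret_meet x y)) <= p) = (val (repr x) <= p) || (val (repr y) <= p).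
Proof. by move=> sp; rewrite ret_reprP//= Spec_mul. Qed.

Lemma ret_join_leP x y (p : A) : Spec A p ->
  (val (repr (ret_join x y)) <= p) = (val (repr x) <= p) && (val (repr y) <= p).
Proof. by move=> sp; rewrite ret_reprP//= leUx. Qed.

Fact ret_le_def x y : ret_le x y = (ret_meet x y == x).
Proof. by []. Qed.
Fact ret_lt_def x y : ret_lt x y = (y != x) && ret_le x y.
Proof. by []. Qed.

Let leP := (ret_meet_leP, ret_join_leP).

Fact ret_meetC : commutative ret_meet.
Proof. by move=> x y; apply: ret_eqP => p sp; rewrite !leP// orbC. Qed.
Fact ret_joinC : commutative ret_join.
Proof. by move=> x y; apply: ret_eqP => p sp; rewrite !leP// andbC. Qed.
Fact ret_meetA : associative ret_meet.
Proof. by move=> x y z; apply: ret_eqP => p sp; rewrite !leP// orbA. Qed.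
Fact ret_joinA : associative ret_join.
Proof. by move=> x y z; apply: ret_eqP => p sp; rewrite !leP// andbA. Qed.
Fact ret_joinKI y x : ret_meet x (ret_join x y) = x.
Proof. by apply: ret_eqP => p sp; rewrite !leP//; do 2!case: (_ <= p). Qed.
Fact ret_meetKU y x : ret_join x (ret_meet x y) = x.
Proof. by apply: ret_eqP => p sp; rewrite !leP//; do 2!case: (_ <= p). Qed.
Fact ret_meetUl : left_distributive ret_meet ret_join.
Proof. by move=> x y z; apply: ret_eqP => p sp; rewrite !leP// orb_andl. Qed.
Fact ret_meetxx : idempotent_op ret_meet.
Proof. by move=> x; apply: ret_eqP => p sp; rewrite !leP// orbb. Qed.

HB.instance Definition _ := Order.isMeetJoinDistrLattice.Build d L
  ret_le_def ret_lt_def ret_meetC ret_joinC ret_meetA ret_joinA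
  ret_joinKI ret_meetKU ret_meetUl ret_meetxx.

Definition ret_bot : L := \pi_L compact_botK.
Definition ret_top : L := \pi_L compact_topK.

Fact ret_le0x x : ret_bot <= x.
Proof.
rewrite leEmeet; apply/eqP/ret_eqP => p sp.
by rewrite [_ `&` _]/(ret_meet _ _) leP// ret_reprP//= le0x.
Qed.

Fact ret_lex1 x : x <= ret_top.
Proof.
rewrite leEmeet; apply/eqP/ret_eqP => p sp.
rewrite [_ `&` _]/(ret_meet _ _) leP// [X in _ || X]ret_reprP//=.
by case: sp => /lt_geF -> _; rewrite orbF.
Qed.

HB.instance Definition _ := Order.hasBottom.Build d L ret_le0x.
HB.instance Definition _ := Order.hasTop.Build d L ret_lex1.

Lemma ret_pi_meet c e :
  (\pi_L c : L) `&` (\pi_L e : L) = \pi_L (compact_mulK c e).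
Proof.
apply: ret_eqP => p sp.
by rewrite [_ `&` _]/(ret_meet _ _) leP// !ret_reprP//= Spec_mul.
Qed.

Lemma ret_pi_join c e :
  (\pi_L c : L) `|` (\pi_L e : L) = \pi_L (compact_joinK c e).
Proof.
apply: ret_eqP => p sp.
by rewrite [_ `|` _]/(ret_join _ _) leP// !ret_reprP//= leUx.
Qed.

Lemma ret_pi_bot : (\bot : L) = \pi_L compact_botK.
Proof. by []. Qed.

Lemma ret_pi_top : (\top : L) = \pi_L compact_topK.
Proof. by []. Qed.

End Reticulation.

(* Main.v *)
Require Import Defs.
From HB Require Import structures.
From mathcomp Require Import all_boot all_order.
From mathcomp Require Import all_classical.

(** Everything is compared with the condition that the m-prime elements form
    an antichain, which is equivalent to [Max A = Spec A] because every element
    below the top lies under an m-prime one. In each of the conditions on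
    compact powers, on the reticulation and on the frame of radical elements, a
    strict inclusion [p < q] of primes is excluded by taking a complemented
    object below [q] but not below [p]: its complement is below [p], hence
    below [q], so that [q] would be the top.

    Conversely, let every prime be maximal and let [c] be compact. The products
    [c ^+ n * e] with [e] compact and [c `|` e = \top] form a multiplicative
    set. A prime [p] avoiding it would not contain [c], so by maximality and
    compactness [c `|` e = \top] for some compact [e <= p], and [e] belongs to
    the set. Hence the set contains [\bot], and this makes a power of [c]
    complemented. *)

Set Implicit Arguments.
Unset Strict Implicit.
Unset Printing Implicit Defensive.

Import Order.LTheory.

Local Open Scope classical_set_scope.
Local Open Scope order_scope.
Local Open Scope quotient_scope.

(** * Compact elements and directed joins *)

Section Compactness.
Context {d : Order.disp_t} {T : completeLatticeType d}.
Implicit Types (c : T) (D F : set T).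

(** Nonemptiness provides the bound for the empty finite subset. *)
Definition up_directed D : Prop :=
  D !=set0 /\
  forall x y, D x -> D y -> exists z, [/\ D z, x <= z & y <= z].

Lemma up_directed_finite_ub D F :
  up_directed D -> finite_set F -> F `<=` D -> exists2 z, D z & ubound F z.
Proof.
move=> [[x0 Dx0] dirD] /finite_seqP[s ->].
elim: s => [|x s IHs] sD; first by exists x0.
have [y Dy suby] : exists2 z, D z & ubound [set` s] z.
  by apply: IHs => t ts; apply: sD; rewrite /= inE; apply/orP; right.
have [|z [Dz xz yz]] := dirD x y _ Dy.
  by apply: sD; rewrite /= inE eqxx.
exists z => // t; rewrite /= inE => /orP[/eqP->//|ts].
exact: le_trans (suby _ ts) yz.
Qed.

Lemma compact_le_directed c D :
  compact_elt c -> up_directed D -> c <= csup D -> exists2 z, D z & c <= z.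
Proof.
move=> cc dirD /cc[F [finF FD cF]].
have [z Dz ubz] := up_directed_finite_ub dirD finF FD.
by exists z => //; apply: le_trans cF _; apply/csup_leP.
Qed.

End Compactness.

(** * Comaximal elements of a quantale *)

Section Comaximality.
Context {d : Order.disp_t} {A : quantaleType d}.
Implicit Types (a b m p x y z : A).

Lemma mulq_le2 x y z t : x <= y -> z <= t -> (x * z <= y * t)%g.
Proof.
move=> xy zt; apply: (le_trans (mulq_leWr _ zt)).
by rewrite ![(_ * t)%g]mulqC; exact: mulq_leWr.
Qed.

Lemma mulqUr x y z : (x * (y `|` z))%g = (x * y)%g `|` (x * z)%g.
Proof.
have csup2 u v : u `|` v = csup [set u; v].
  apply/le_anti/andP; split.
    by rewrite leUx !csup_ub //; [right|left].
  by apply/csup_leP => w [->|->]; rewrite ?leUl ?leUr.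
rewrite !csup2 mulq_csup; congr csup.
by rewrite image_setU !image_set1.
Qed.

(** Once the product is expanded, every term other than [x * y] has a factor [z]. *)
Lemma mulq_joins_le x y z : ((x `|` z) * (y `|` z) <= (x * y)%g `|` z)%g.
Proof.
rewrite mulqUr leUx; apply/andP; split; last first.
  exact: le_trans (mulq_leIr _ _) (leUr _ _).
rewrite mulqC mulqUr leUx [(y * x)%g]mulqC leUl /=.
exact: le_trans (mulq_leIr _ _) (leUr _ _).
Qed.

Lemma comax_mul x y z :
  x `|` z = \top -> y `|` z = \top -> (x * y)%g `|` z = \top.
Proof.
move=> xz yz; apply/le_anti; rewrite lex1 /=.
by have := mulq_joins_le x y z; rewrite xz yz -oneq_top mulg1.
Qed.

Lemma comax_exp x z n : x `|` z = \top -> (x ^+ n)%g `|` z = \top.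
Proof.
move=> xz; elim: n => [|n IHn]; first by rewrite expg0 oneq_top join1x.
by rewrite expgS; exact: comax_mul.
Qed.

(** Multiply the meet by [\top], written as the join of [x] and [y]: each of the two resulting
    products is below [x * y]. *)
Lemma comax_meet x y : x `|` y = \top -> x `&` y = (x * y)%g.
Proof.
move=> xy; apply/le_anti/andP; split; last by rewrite lexI mulq_leIl mulq_leIr.
rewrite -[X in X <= _]mulg1 oneq_top -xy mulqUr leUx; apply/andP; split.
  by rewrite [(x * y)%g]mulqC; apply: mulq_le2 => //; exact: leIr.
by apply: mulq_le2 => //; exact: leIl.
Qed.

Lemma Spec_exp p x n : Spec A p -> (x ^+ n.+1 <= p)%g = (x <= p).
Proof.
move=> sp; elim: n => [|n IHn]; first by rewrite expg1.
by rewrite expgS Spec_mul// IHn orbb.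
Qed.

Lemma Max_comax m x : Max A m -> ~ x <= m -> x `|` m = \top.
Proof.
move=> [mT maxm] xm; apply/eqP/negPn/negP => xmT; apply: xm.
by rewrite -(maxm _ xmT (leUr _ _)) leUl.
Qed.

(** If neither factor is below [m], both are comaximal with [m], hence so is their product; being
    below [m], it would force [m = \top]. *)
Lemma Max_sub_Spec : Max A `<=` Spec A.
Proof.
move=> m Mm; split; first by case: Mm => mT _; rewrite lt_neqAle mT lex1.
move=> a b abm; apply: contrapT => /not_orP[am bm].
case: (Mm) => /eqP mT _; apply: mT.
by rewrite -(comax_mul (Max_comax Mm am) (Max_comax Mm bm)); apply/esym/join_r.
Qed.

End Comaximality.

(** * Separation by m-prime elements *)

Section PrimeSeparation.
Context {d : Order.disp_t} {A : coherentQuantaleType d}.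
Implicit Types (a b c e p q x : A) (S : set A).

Lemma compact_exp c n : compact_elt c -> compact_elt (c ^+ n)%g.
Proof.
move=> cc; elim: n => [|n IHn]; first by rewrite expg0 oneq_top; exact: compact_top.
by rewrite expgS; exact: compact_mul.
Qed.

Lemma compact_nle a b :
  ~ a <= b -> exists c, [/\ compact_elt c, c <= a & ~ c <= b].
Proof.
have [S [Scpt ->]] := compactly_generated a => nle.
apply: contrapT => none; apply: nle; apply/csup_leP => c Sc.
apply: contrapT => cb; apply: none; exists c.
by split=> //; [exact: Scpt | exact: csup_ub].
Qed.

(** By coherence [\top] is the directed join of the joins of [a] with the compact elements below
    [b]; compactness of [\top] selects one of them. *)
Lemma comax_compact a b :
  a `|` b = \top -> exists e, [/\ compact_elt e, e <= b & a `|` e = \top].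
Proof.
move=> ab; pose D := [set a `|` e | e in [set e | compact_elt e /\ e <= b]].
have dirD : up_directed D.
  split; first by exists (a `|` \bot); exists \bot => //; split;
    [exact: compact_bot | exact: le0x].
  move=> _ _ [e [ce eb] <-] [f [cf fb] <-]; exists (a `|` (e `|` f)); split.
  - exists (e `|` f) => //; split; first exact: compact_join.
    by rewrite leUx eb.
  - by rewrite leU2// leUl.
  - by rewrite leU2// leUr.
have topD : \top <= csup D.
  rewrite -ab leUx; apply/andP; split.
    apply: le_trans (csup_ub _); first exact: (leUl a \bot).
    by exists \bot => //; split; [exact: compact_bot | exact: le0x].
  apply: contrapT => /compact_nle[c [cc cb]]; apply.
  apply: le_trans (csup_ub _); first exact: (leUr c a).
  by exists c.
have [_ [e [ce eb] <-] te] := compact_le_directed compact_top dirD topD.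
by exists e; split => //; apply/le_anti; rewrite lex1.
Qed.

(** Zorn's lemma gives a maximal element above [a] avoiding [S]; compactness of the members of [S]
    keeps joins of nonempty chains in play. *)
Lemma prime_separation S a :
  S \top -> (forall s t, S s -> S t -> S (s * t)%g) -> S `<=` compact_elt ->
  (forall s, S s -> ~ s <= a) ->
  exists p, [/\ Spec A p, a <= p & forall s, S s -> ~ s <= p].
Proof.
move=> S1 SM Scpt Sa.
pose avoids x := a <= x /\ forall s, S s -> ~ s <= x.
pose T := {x : A | `[< avoids x >]}.
pose toT x (av : avoids x) : T :=
  exist (fun x => is_true `[< avoids x >]) x (asboolT av).
have avoids_val (u : T) : avoids (val u) by exact/asboolP/(valP u).
have [|||C totC|m maxm] := @Zorn T (fun u v => val u <= val v).
- by move=> u.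
- by move=> u v w; exact: le_trans.
- by move=> u v uv vu; apply/val_inj/le_anti; rewrite uv.
(* The empty chain is bounded by [a] itself, as its join [\bot] need not be above [a]. *)
- have [[u0 Cu0]|C0] := pselect (C !=set0); last first.
    have aa : avoids a by split.
    by exists (toT a aa) => u Cu; case: C0; exists u.
  have dirC : up_directed [set val u | u in C].
    split; first by exists (val u0); exists u0.
    move=> _ _ [u Cu <-] [v Cv <-]; have [uv|vu] := totC _ _ Cu Cv.
      by exists (val v); split=> //; exists v.
    by exists (val u); split=> //; exists u.
  have av : avoids (csup [set val u | u in C]).
    split.
      have [au0 _] := avoids_val u0.
      by apply: le_trans au0 _; apply: csup_ub; exists u0.
    move=> s Ss /(compact_le_directed (Scpt _ Ss) dirC)[_ [u _ <-] su].
    by have [_ /(_ _ Ss)] := avoids_val u.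
  by exists (toT _ av) => u Cu; apply: csup_ub; exists u.
have [am Sm] := avoids_val m.
have meetsS b : ~ b <= val m -> exists2 s, S s & s <= b `|` val m.
  move=> bm; apply: contrapT => none.
  have av : avoids (b `|` val m).
    split; first exact: le_trans am (leUr _ _).
    by move=> s Ss sbm; apply: none; exists s.
  have := maxm (toT _ av) (leUr _ _).
  by move=> /(congr1 val) eqm; apply: bm; rewrite -eqm leUl.
exists (val m); split=> //; split.
  rewrite lt_neqAle lex1 andbT; apply/eqP => mT.
  by apply: (Sm _ S1); rewrite mT.
(* By maximality, joining [b] or [e] to [m] captures some [s] or [t] of [S]; then [s * t] is in [S]
   and below [m]. *)
move=> b e bem; apply: contrapT => /not_orP[/meetsS[s Ss sb] /meetsS[t St te]].
apply: (Sm _ (SM _ _ Ss St)).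
apply: le_trans (mulq_le2 sb te) _; apply: le_trans (mulq_joins_le _ _ _) _.
by rewrite leUx bem lexx.
Qed.

Lemma le_Spec a : a != \top -> exists2 p, Spec A p & a <= p.
Proof.
move=> aT; have [|s t -> ->|s ->||p [sp ap _]] := @prime_separation [set \top] a.
- by [].
- by rewrite -oneq_top mulg1.
- exact: compact_top.
- by move=> s -> ta; case/eqP: aT; apply/le_anti; rewrite lex1.
by exists p.
Qed.

Lemma Max_eq_SpecP :
  Max A = Spec A <-> forall p q, Spec A p -> Spec A q -> p <= q -> q <= p.
Proof.
split=> [MS p q sp [qT _] pq|anti].
  have [_ maxp] : Max A p by rewrite MS.
  by rewrite (maxp q) // (lt_eqF qT).
apply/seteqP; split; first exact: Max_sub_Spec.
move=> p sp; split; first by case: sp => /lt_eqF->.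
move=> a /le_Spec[q sq aq] pa; apply/le_anti; rewrite pa andbT.
exact: le_trans aq (anti _ _ sp sq (le_trans pa aq)).
Qed.

End PrimeSeparation.

(** * The implications between the conditions *)

Section Characterizations.
Context {d : Order.disp_t} (A : coherentQuantaleType d).
Implicit Types (a c e p q : A).
Local Notation L := (reticulation A).

Lemma Max_eq_Spec_hyperarchimedean : Max A = Spec A -> hyperarchimedean A.
Proof.
move=> MS c cc.
pose S := [set s : A | exists n e,
  [/\ compact_elt e, c `|` e = \top & s = (c ^+ n * e)%g]].
have [[n [e [ce cVe ne0]]]|S0] := pselect (S \bot).
  (* Since [n] may be 0, the exponent is [n.+1]. The meet with the comaximal [e] is the product, a
     multiple of [c ^+ n * e = \bot]. *)
  exists n.+1; split => //; exists e.
  have cnVe := comax_exp n.+1 cVe; split=> //.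
  rewrite comax_meet// expgS -mulgA -ne0; apply/le_anti.
  by rewrite le0x mulq_leIr.
have [|s t [n [e [ce cVe ->]]] [m [f [cf cVf ->]]]|||p [sp _ Sp]] :=
    @prime_separation d A S \bot.
- by exists 0, \top; rewrite joinx1 mul1g; split=> //; exact: compact_top.
- exists (n + m)%N, (e * f)%g; split; first exact: compact_mul.
    by rewrite joinC; apply: comax_mul; rewrite joinC.
  by rewrite expgnDr -!mulgA; congr (_ * _)%g; rewrite !mulgA [(e * _)%g]mulqC.
- move=> _ [n [e [ce _ ->]]]; apply: compact_mul => //; exact: compact_exp.
- by move=> s Ss s0; apply: S0; rewrite (_ : \bot = s) //;
    apply/le_anti; rewrite le0x.
have Mp : Max A p by rewrite MS.
have cp : ~ c <= p.
  apply: Sp; exists 1%N, \top; split; first exact: compact_top.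
    by rewrite joinx1.
  by rewrite expg1 -oneq_top mulg1.
have [e [ce ep cVe]] := comax_compact (Max_comax Mp cp).
by case: (Sp e) => //; exists 0, e; rewrite mul1g.
Qed.

Lemma hyperarchimedean_boolean : hyperarchimedean A -> boolean_algebra L.
Proof.
move=> hA x; rewrite -(reprK x); set c := repr x.
have [[|n] [// _ [b [cb0 cbT]]]] := hA _ (@compactEltP _ _ c).
(* The complement [b] is shrunk to a compact element, so that it has a class in [L]. *)
have [e [ce eb ceT]] := comax_compact cbT.
pose k : compactElt A := CompactElt (asboolT ce).
exists (\pi_L k); rewrite ret_pi_meet ret_pi_join ret_pi_bot ret_pi_top.
split; apply/ret_piP => p sp /=.
  rewrite le0x Spec_mul// -(Spec_exp _ n sp) -Spec_meet//.
  by apply: le_trans (le0x p); rewrite -cb0 leI2.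
by rewrite leUx -(Spec_exp _ n sp) -leUx ceT.
Qed.

Lemma boolean_Max_eq_Spec : boolean_algebra L -> Max A = Spec A.
Proof.
move=> bL; apply/Max_eq_SpecP => p q sp sq pq.
apply: contrapT => /compact_nle[c [cc cq cp]].
pose k : compactElt A := CompactElt (asboolT cc).
have [y] := bL (\pi_L k); rewrite -(reprK y); set e := repr y.
rewrite ret_pi_meet ret_pi_join ret_pi_bot ret_pi_top.
(* The meet identity is read at [p], the join identity at [q]. *)
move=> [/ret_piP/(_ p sp)/= + /ret_piP/(_ q sq)/=].
rewrite le0x Spec_mul// => /orP[//|ep].
rewrite leUx cq (le_trans ep pq) => /esym qT.
by case: sq => /lt_geF; rewrite qT.
Qed.

Lemma hyperarchimedean_zero_dimensional :
  hyperarchimedean A -> zero_dimensional (radElt A).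
Proof.
move=> hA x; exists [set z | complemented z /\ z <= x]; split; first by move=> z [].
apply/le_anti/andP; split; last by apply/csup_leP => z [].
rewrite rad_leE; apply: contrapT => /compact_nle[c [cc cx]]; apply.
have [[|n] [// _ [b [cb0 cbT]]]] := hA c cc.
(* Thus the radical of the complemented power is a complemented element of the frame, above [c] and
   below [x]. *)
have rcE : rho (c ^+ n.+1)%g = rho c by apply/rho_eqP => p; exact: Spec_exp.
apply: le_trans (le_rho c) _; rewrite -rcE.
change (rad (c ^+ n.+1)%g <= csup [set z : radElt A | complemented z /\ z <= x]).
apply: csup_ub; split; last by rewrite rad_leE /= rcE rho_rad_le.
exists (rad b); split; apply/val_inj.
  by rewrite rad_val_meet rad_val_bot /= -rhoI cb0.
rewrite rad_val_join rad_val_top /=; apply/le_anti; rewrite lex1 /= -cbT.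
by apply: le_trans (le_rho _); rewrite leU2// le_rho.
Qed.

Lemma zero_dimensional_Max_eq_Spec :
  zero_dimensional (radElt A) -> Max A = Spec A.
Proof.
move=> zd; apply/Max_eq_SpecP => p q sp sq pq.
have [S [Scompl radqE]] := zd (rad q).
(* Radicals are invisible to the prime [p], so it suffices to test the generators of [rad q] one by
   one. *)
rewrite -(Spec_rho q sp) -[rho q]/(val (rad q)) radqE rad_val_csup Spec_rho//.
apply/csup_leP => _ [x Sx <-]; apply: contrapT => xp.
have xq : val x <= q.
  have : x <= rad q by rewrite radqE; exact: csup_ub.
  by rewrite rad_leE => /le_trans; apply; rewrite Spec_rho.
have [y [/(congr1 val) xy0 /(congr1 val) xyT]] := Scompl x Sx.
have : val x `&` val y <= p by rewrite -rad_val_meet xy0 rad_val_bot Spec_rho// le0x.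
rewrite Spec_meet// => /orP[//|yp].
have : rho (val x `|` val y) <= q by rewrite Spec_rho// leUx xq (le_trans yp).
by rewrite -rad_val_join xyT rad_val_top; case: sq => /lt_geF ->.
Qed.

End Characterizations.

Theorem theorem4p7 (d : Order.disp_t) (A : coherentQuantaleType d) :
  [/\ hyperarchimedean A <-> boolean_algebra (reticulation A),
      boolean_algebra (reticulation A) <-> Max A = Spec A
    & semiprime A -> (hyperarchimedean A <-> zero_dimensional (radElt A))].
Proof.
have h2b := @hyperarchimedean_boolean d A.
have b2m := @boolean_Max_eq_Spec d A.
have m2h := @Max_eq_Spec_hyperarchimedean d A.
split; first by split=> // /b2m.
  by split=> // /m2h.
move=> _; split; first exact: hyperarchimedean_zero_dimensional.
by move/zero_dimensional_Max_eq_Spec.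
Qed.
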